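(* Let $G$ be a finite, simple, undirected, connected graph without isolated vertices, with type partition $\{V_1,\dots,V_t\}$ and corresponding type graph $H$, where $H$ has no isolated vertices (so that $\chi_{ON}(H)$ is defined). Let $cl(G)$ be the number of sets $V_i$ in the type partition that form a clique. Then $$\chi_{ON}(G)\le \chi_{ON}(H)+\frac{cl(G)}{2}+2 .$$
   Context: A CFON coloring of a graph $G=(V,E)$ using $k$ colors is an assignment $C:V(G)\to\{1,\dots,k\}$ such that for every $v\in V(G)$ there exists $i\in\{1,\dots,k\}$ with $|N(v)\cap C^{-1}(i)|=1$, where $N(v)$ is the open neighborhood of $v$. $\chi_{ON}(G)$ is the smallest number of colors required for a CFON coloring of $G$ (graphs with isolated vertices have no CFON coloring). Two vertices $v,w$ of $G$ have the same type if $N(v)\setminus\{w\}=N(w)\setminus\{v\}$. A type partition of $G$ is a partition of $V(G)$ into (nonempty) sets $V_1,\dots,V_t$ such that all the vertices in each $V_i$ have the same type. Each $V_i$ then forms a clique or an independent set, and for $i\ne j$ either every vertex of $V_i$ is adjacent to every vertex of $V_j$, or no vertex of $V_i$ is adjacent to any vertex of $V_j$. The type graph is $H=(\{1,\dots,t\},E_H)$ with $E_H=\{\{i,j\}:1\le i<j\le t,\ \text{each vertex of } V_i \text{ is a neighbor of each vertex of } V_j\}$. *)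

(* Defs.v *)
(* A finite simple graph is a symmetric irreflexive
   relation [e : rel T] on a finite type [T]. *)
From HB Require Import structures.
From mathcomp Require Import all_boot all_order all_algebra.

Set Implicit Arguments.
Unset Strict Implicit.
Unset Printing Implicit Defensive.

Definition nbhd (T : finType) (e : rel T) (v : T) : {set T} := [set w | e v w].

Definition no_isolated (T : finType) (e : rel T) : Prop :=
  forall v, nbhd e v != set0.

Definition connected_graph (T : finType) (e : rel T) : Prop :=
  forall v w, connect e v w.

(* The colours 1, ..., k are encoded as the elements of ['I_k]. *)
Definition CFON_coloring (T : finType) (e : rel T) (k : nat)
    (C : {ffun T -> 'I_k}) : bool :=
  [forall v, exists i, #|nbhd e v :&: C @^-1: [set i]| == 1].

Definition CFON_colorable (T : finType) (e : rel T) (k : nat) : bool :=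
  [exists C : {ffun T -> 'I_k}, CFON_coloring e C].

Lemma no_isolated_CFON (T : finType) (e : rel T) :
  no_isolated e -> exists k, CFON_colorable e k.
Proof.
move=> noiso; exists #|T|; apply/existsP; exists [ffun v => enum_rank v].
apply/forallP => v; have /set0Pn[w vw] := noiso v.
apply/existsP; exists (enum_rank w); apply/cards1P; exists w.
apply/setP => u; rewrite !inE ffunE (inj_eq enum_rank_inj).
by case: eqP => [->|_]; rewrite ?andbF // andbT; rewrite inE in vw.
Qed.

(* Only defined for graphs without isolated vertices, hence the proof argument;
   the value does not depend on it, by [chi_ONP]. *)
Definition chi_ON (T : finType) (e : rel T) (noiso : no_isolated e) : nat :=
  ex_minn (no_isolated_CFON noiso).

Lemma chi_ONP (T : finType) (e : rel T) (noiso : no_isolated e) :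
  CFON_colorable e (chi_ON noiso) /\
  (forall k, CFON_colorable e k -> chi_ON noiso <= k).
Proof. by rewrite /chi_ON; case: ex_minnP. Qed.

Definition same_type (T : finType) (e : rel T) (v w : T) : bool :=
  nbhd e v :\ w == nbhd e w :\ v.

(* The classes are indexed without repetition; [partition] makes them nonempty,
   disjoint and covering.  They need not be the maximal classes. *)
Definition type_partition (T : finType) (e : rel T) (t : nat)
    (V : 'I_t -> {set T}) : Prop :=
  [/\ injective V, partition [set V i | i : 'I_t] [set: T]
    & forall i, {in V i &, forall v w, same_type e v w}].

Definition type_graph (T : finType) (e : rel T) (t : nat)
    (V : 'I_t -> {set T}) : rel 'I_t :=
  [rel i j | (i != j) && [forall v in V i, forall w in V j, e v w]].

(* Singletons are cliques. *)
Definition is_clique (T : finType) (e : rel T) (A : {set T}) : bool :=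
  [forall v in A, forall w in A, (v != w) ==> e v w].

Definition cl (T : finType) (e : rel T) (t : nat) (V : 'I_t -> {set T}) : nat :=
  #|[set i | is_clique e (V i)]|.

(* Main.v *)
(** Start from a CFON coloring [C] of [H] with [k] colors.  Color one
    representative of each [V i] by [C i] and all other vertices by a dummy
    color.  If [u i] is a neighbor of [i] whose color is unique around [i], then
    the representative of [u i] serves every vertex of [V i], except when [V i]
    is a clique and [C (u i) = C i]; call such an [i] bad.

    If at least two cliques have color [c], one new color repairs all bad [i] of
    color [c]: in the subgraph of [H] induced by color [c] a bad [i] is a leaf
    attached to [u i], so one can move some of the bad [i] to the new color in
    such a way that [i] and [u i] always get separated.  Splitting a color class
    never destroys uniqueness.

    If the bad [i] is the only clique of its color, then [V (u i)] is not
    a clique, so it has a second vertex [s i], whose dummy color serves nobody.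
    One new color repairs two such indices [i, i']: use it on [s i'] alone if [i]
    is adjacent to [u i'], on [s i] alone if [i'] is adjacent to [u i], and on
    both otherwise.  Thus each new color is paid for by two cliques, up to
    rounding. *)
Require Import Defs.
From mathcomp Require Import all_boot all_order all_algebra.
From mathcomp Require Import zify lra.

Set Implicit Arguments.
Unset Strict Implicit.
Unset Printing Implicit Defensive.

Import Order.TTheory GRing.Theory Num.Theory.

(** Colors may be taken in any type with decidable equality: the position in [D] turns them into
    numbers below [size D], and it separates distinct members of [D]. *)
Lemma chi_ON_le_size (T : finType) (e : rel T) (noiso : no_isolated e)
    (K : eqType) (F : T -> K) (D : seq K) :
    (forall v, F v \in D) ->
    (forall v, exists2 w, e v w & forall z, e v z -> F z = F w -> z = w) ->
  chi_ON noiso <= size D.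
Proof.
move=> FD Funiq; apply: (proj2 (chi_ONP noiso)).
have ltD v : index (F v) D < size D by rewrite index_mem.
apply/existsP; exists [ffun v => Ordinal (ltD v)]; apply/forallP => v.
have [w vw wP] := Funiq v; apply/existsP; exists (Ordinal (ltD w)).
apply/cards1P; exists w; apply/setP => z; rewrite !inE ffunE.
apply/andP/eqP => [[vz /eqP[idx]]|->]; last by [].
apply: wP => //; rewrite -(nth_index (F w) (FD z)) idx.
exact: nth_index.
Qed.

(** By induction, two elements of [N] are removed at a time, and the pair costs one fresh color. In
    the application [a i j] says that [i] is adjacent to [u j], and [S] holds the [j] for which
    [s j] gets the new color [g j]. *)
Lemma half_colors (I : finType) (a : rel I) (N : {set I}) : reflexive a ->
  exists g : I -> nat, exists S : {set I},
    [/\ S \subset N, {in S, forall i, g i < uphalf #|N|}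
      & {in N, forall i, exists j, [/\ j \in S, a i j
          & {in S, forall l, a i l -> g l = g j -> l = j}]}].
Proof.
move=> aR; elim: {N}_.+1 {-2}N (ltnSn #|N|) => // n IHn N leN.
have [N0|[x xN]] := set_0Vmem N.
  by exists (fun=> 0), set0; split; rewrite ?sub0set // => i; rewrite ?N0 inE.
have [N1|[y]] := set_0Vmem (N :\ x).
  have {}N1 i : i \in N -> i = x.
    by move=> iN; apply/eqP; have:= in_set0 i; rewrite -N1 !inE iN andbT => /negbFE.
  exists (fun=> 0), N; split=> // [i _|i /N1->].
    by rewrite (cardsD1 x) xN.
  by exists x; split=> // l /N1.
rewrite !inE => /andP[neq_yx yN].
pose N' := N :\ x :\ y.
have cN : #|N| = #|N'|.+2 by rewrite (cardsD1 x) xN (cardsD1 y) !inE neq_yx yN.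
have [|g [S [SN gS SP]]] := IHn N'; first by lia.
have xS : x \notin S by apply/negP => /(subsetP SN); rewrite !inE eqxx andbF.
have yS : y \notin S by apply/negP => /(subsetP SN); rewrite !inE eqxx.
(* By reflexivity, a one-element [P] serves both [x] and [y]. In the last case neither is related to
   the other, so each sees only itself in [P]. *)
pose P : {set I} := if a x y then [set y] else if a y x then [set x] else [set x; y].
have Pxy i : i \in P -> (i == x) || (i == y).
  by rewrite /P; case: ifP => _; [|case: ifP => _]; rewrite !inE => ->; rewrite ?orbT.
have PS i : i \in P -> i \notin S by move=> /Pxy/orP[]/eqP->.
(* All colors given by the induction hypothesis are below [m], so [P] cannot spoil uniqueness for
   the elements of [N']. *)
pose m := uphalf #|N'|.
exists (fun i => if i \in P then m else g i), (P :|: S); split.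
- apply/subsetP => i; rewrite inE => /orP[/Pxy/orP[]/eqP->//|/(subsetP SN)].
  by rewrite !inE => /and3P[].
- move=> i; rewrite cN /= inE; case: ifP => //= _ /gS; rewrite -/m; lia.
move=> i iN; case xy_i: ((i == x) || (i == y)); last first.
  have /SP[j [jS aij jP]] : i \in N'.
    by rewrite !inE iN andbT; case: (i == x) xy_i; case: (i == y).
  have jP' : j \notin P by apply: contraL jS => /PS.
  exists j; rewrite inE jS orbT; split=> // l; rewrite inE (negPf jP').
  case: ifP => [lP _ _ gj|_ /= lS]; last exact: jP.
  by have:= gS j jS; rewrite -gj ltnn.
have [j jP [aij jU]] : exists2 j, j \in P & a i j /\ {in P, forall l, a i l -> l = j}.
  rewrite /P; case axy: (a x y); last case ayx: (a y x).
  - exists y; rewrite ?inE //; split; last by move=> l /set1P.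
    by case/orP: xy_i => /eqP->.
  - exists x; rewrite ?inE //; split; last by move=> l /set1P.
    by case/orP: xy_i => /eqP->.
  - exists i; first by rewrite !inE.
    by split=> // l; case/orP: xy_i => /eqP-> /set2P[]->; rewrite ?axy ?ayx.
exists j; rewrite inE jP; split=> // l; rewrite inE.
case: ifP => [lP _ ail _|_ /= lS _ gl]; first exact: jU.
by have:= gS l lS; rewrite gl ltnn.
Qed.

(** Each color in [A] accounts for at least two elements of [Q], and all of these lie outside
    [N]. *)
Lemma cliques_of_color_count (I K : finType) (Q N : {set I}) (C : I -> K) :
    N \subset Q ->
  let A := [set c | 1 < #|[set i in Q | C i == c]|] in
    {in N, forall i, C i \notin A} ->
  2 * #|A| + #|N| <= #|Q|.
Proof.
move=> NQ A NA; pose QA := [set i in Q | C i \in A].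
have QAE : #|QA| = \sum_(c in A) #|[set i in Q | C i == c]|.
  rewrite -sum1_card (partition_big C (mem A)) /=; last first.
    by move=> i; rewrite inE => /andP[].
  apply: eq_bigr => c cA; rewrite -sum1_card; apply: eq_bigl => i.
  by rewrite !inE; case: eqP => [->|]; rewrite ?andbF // inE in cA *; rewrite cA !andbT.
have leA : 2 * #|A| <= #|QA|.
  by rewrite QAE mulnC -sum_nat_const; apply: leq_sum => c; rewrite inE.
have dis : [disjoint QA & N].
  rewrite -setI_eq0; apply/eqP/setP => i; rewrite !inE.
  by apply/negP => /andP[/andP[_ iA] /NA]; rewrite inE iA.
have [_] := leq_card_setU QA N; rewrite dis => /eqP cU.
apply: leq_trans (_ : #|QA :|: N| <= _); first by rewrite cU leq_add2r.
apply: subset_leq_card; rewrite subUset NQ andbT.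
by apply/subsetP => i; rewrite inE => /andP[].
Qed.

Section TypePartition.

Variables (T : finType) (e : rel T).
Hypotheses (e_sym : symmetric e) (e_irr : irreflexive e).
Variables (t : nat) (V : 'I_t -> {set T}).
Hypothesis V_type : type_partition e V.

Let H := type_graph e V.

Lemma same_type_edge i v v' w :
  v \in V i -> v' \in V i -> w != v' -> e v w -> e v' w.
Proof.
case: V_type => _ _ sameV vi v'i wv' vw.
have /eqP/setP/(_ w) := sameV i v v' vi v'i.
by rewrite !inE wv' vw => /esym/andP[].
Qed.

Lemma type_class v : exists i, v \in V i.
Proof.
case: V_type => _ /and3P[/eqP cV _ _] _.
have : v \in cover [set V i | i : 'I_t] by rewrite cV inE.
by move=> /bigcupP[A /imsetP[i _ ->] vi]; exists i.
Qed.

Lemma type_class_inj i j v : v \in V i -> v \in V j -> i = j.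
Proof.
case: V_type => V_inj /and3P[_ tV _] _ vi vj; apply: V_inj.
by rewrite -(def_pblock tV _ vi) ?imset_f // -(def_pblock tV _ vj) ?imset_f.
Qed.

Lemma type_class_mem i : exists v, v \in V i.
Proof.
case: V_type => _ /and3P[_ _ V0] _; apply/set0Pn.
by apply: contra V0 => /eqP <-; apply: imset_f.
Qed.

Lemma type_graph_sym : symmetric H.
Proof.
suff sub i j : H i j -> H j i by move=> i j; apply/idP/idP; apply: sub.
case/andP=> ij /forall_inP Hij; rewrite /H /type_graph /= eq_sym ij /=.
apply/forall_inP => v vj; apply/forall_inP => w wi; rewrite e_sym.
by move/forall_inP: (Hij w wi); apply.
Qed.

Lemma type_graph_edge i j v w : v \in V i -> w \in V j -> H i j -> e v w.
Proof. by move=> vi wj /andP[_ /forall_inP/(_ v vi)/forall_inP/(_ w wj)]. Qed.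

(** The edge is transported one endpoint at a time; disjointness of the classes gives the
    inequalities required by [same_type_edge]. *)
Lemma edge_type_graph i j v w :
  v \in V i -> w \in V j -> e v w -> i != j -> H i j.
Proof.
move=> vi wj vw ij; rewrite /H /type_graph /= ij /=.
have neq x y : x \in V i -> y \in V j -> y != x.
  by move=> xi yj; apply: contraNneq ij => yx; rewrite (@type_class_inj i j x) // -yx.
apply/forall_inP => x xi; apply/forall_inP => y yj.
rewrite e_sym; apply: (same_type_edge wj yj); first by rewrite eq_sym neq.
by rewrite e_sym; apply: (same_type_edge vi xi) => //; apply: neq.
Qed.

(** Sharing the type of [w] makes every other vertex of the class adjacent to [v]; sharing the type
    of [v] then makes any two of them adjacent. *)
Lemma edge_clique i v w : v \in V i -> w \in V i -> e v w -> is_clique e (V i).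
Proof.
move=> vi wi vw; have vN y : y \in V i -> y != v -> e v y.
  have wv : v != w by apply: contraTneq vw => ->; rewrite e_irr.
  move=> yi yv; rewrite e_sym; have [->|yw] := eqVneq y w; first by rewrite e_sym.
  by apply: (same_type_edge wi yi); rewrite 1?e_sym // eq_sym.
apply/forall_inP => x xi; apply/forall_inP => y yi; apply/implyP => xy.
have [yv|yv] := eqVneq y v; first by rewrite yv e_sym vN // -yv.
by apply: (same_type_edge vi xi); rewrite ?vN // eq_sym.
Qed.

End TypePartition.

Local Open Scope ring_scope.

Theorem theorem13 (T : finType) (e : rel T)
    (e_sym : symmetric e) (e_irr : irreflexive e)
    (e_conn : connected_graph e) (e_noiso : no_isolated e)
    (t : nat) (V : 'I_t -> {set T}) (V_type : type_partition e V)
    (H_noiso : no_isolated (type_graph e V)) :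
  (chi_ON e_noiso)%:R <= (chi_ON H_noiso)%:R + (cl e V)%:R / 2 + 2 :> rat.
Proof.
suff: (2 * chi_ON e_noiso <= 2 * chi_ON H_noiso + cl e V + 4)%N.
  by rewrite -(ler_nat rat) !natrD => ?; lra.
set k := chi_ON H_noiso; pose H := type_graph e V.
have [C CP] : exists C : 'I_t -> 'I_k, forall i, exists2 j, H i j &
    forall l, H i l -> C l = C j -> l = j.
  have [/existsP[C /forallP CP] _] := chi_ONP H_noiso; exists C => i.
  have /existsP[c /cards1P[j jP]] := CP i.
  have mem l : (H i l && (C l == c)) = (l == j).
    by move/setP/(_ l): jP; rewrite !inE.
  have /andP[ij /eqP Cj] : H i j && (C j == c) by rewrite mem.
  by exists j => // l il Cl; apply/eqP; rewrite -mem il Cl Cj eqxx.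
have [r rV] := fin_all_exists (type_class_mem V_type).
have [b bV] := fin_all_exists (type_class V_type).
have bE i v : v \in V i -> b v = i by move=> vi; exact: (type_class_inj V_type (bV v) vi).
have br i : b (r i) = i by apply: bE.
have [u Hu uU] := fin_all_exists2 CP.
pose Q := [set i | is_clique e (V i)].
pose B := [set i in Q | C (u i) == C i].
pose A := [set c | (1 < #|[set i in Q | C i == c]|)%N].
pose N := [set i in B | C i \notin A].
(* These are the indices moved to the second copy of their color. If [u i] is bad too, [i] and [u i]
   point at each other, and comparing them moves exactly one. *)
pose R := [set i in B | (C i \in A) && ((u i \notin B) || (i < u i)%N)].
have edgeP v z : e v z -> H (b v) (b z) \/ b v = b z /\ b v \in Q.
  move=> vz; have [bvz|bvz] := eqVneq (b v) (b z); [right|left].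
    by split=> //; rewrite inE (edge_clique e_sym e_irr V_type (bV v) _ vz) // bvz.
  exact: (edge_type_graph e_sym V_type (bV v) (bV z) vz bvz).
have HirrN i j : H i j -> i != j by case/andP.
have A_inj i j : i \in Q -> j \in Q -> C i = C j -> C i \notin A -> i = j.
  move=> iQ jQ Cij; rewrite [_ \in A]inE -leqNgt => /card_le1_eqP le1.
  by apply: le1; rewrite inE ?iQ ?jQ ?Cij eqxx.
have BP i : i \in B -> i \in Q /\ C (u i) = C i.
  by rewrite inE => /andP[-> /eqP].
have NP i : i \in N -> [/\ i \in Q, C (u i) = C i & C i \notin A].
  by rewrite inE => /andP[/BP[]].
have uN i : i \in N -> u i \notin Q.
  case/NP => iQ Cu CA; apply/negP => uQ.
  by have /eqP[] := HirrN _ _ (Hu i); apply: A_inj.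
have N_inj : {in N &, injective u}.
  move=> i j /NP[iQ Ci CA] /NP[jQ Cj _] uij.
  by apply: A_inj => //; rewrite -Ci uij.
have RE i : i \in B -> C i \in A -> (u i \in R) = (i \notin R).
  move=> iB CA; have [_ Cui] := BP i iB.
  rewrite ![_ \in R]inE iB CA Cui CA /=.
  case uB: (u i \in B) => //=; have [_ Cuui] := BP _ uB.
  (* Around [u i], the vertex [i] already has the color of [u (u i)], which is unique there. *)
  have uui : u (u i) = i.
    by apply/esym/uU; [rewrite /H type_graph_sym | rewrite Cuui].
  rewrite uui iB /= -leqNgt ltn_neqAle; case: eqP => [uii|] //.
  by have := HirrN _ _ (Hu i); rewrite eq_sym -val_eqE /= uii eqxx.
(* The guard inside the existential makes [s] total. Singletons are cliques, so the non-clique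
   [V (u i)] has a second vertex. *)
have sE i : exists x, i \in N -> x \in V (u i) /\ x != r (u i).
  case iN: (i \in N); last by exists (r i).
  have /negP := uN i iN; rewrite inE => nQ.
  have [|[v]] := set_0Vmem (V (u i) :\ r (u i)); last first.
    by rewrite !inE => /andP[? ?]; exists v.
  move=> V1; case: nQ.
  have V1' v : v \in V (u i) -> v = r (u i).
    move=> vV; apply/eqP; have := in_set0 v.
    by rewrite -V1 !inE vV andbT => /negbFE.
  apply/forall_inP => v /V1'->; apply/forall_inP => w /V1'->.
  by rewrite eqxx.
have [s sP] := fin_all_exists sE.
have [g [S [SN gS SP]]] := @half_colors _ [rel i j | H i (u j)] N Hu.
have sS i : i \in S -> s i \in V (u i) /\ s i != r (u i).
  by move/(subsetP SN)/sP.
(* [inl] marks representatives, with a bit for membership in [R]; [inr] marks the extra vertices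
   [s i]; [None] is the dummy color. *)
pose F v : option ('I_k * bool + nat) :=
  if v == r (b v) then Some (inl (C (b v), b v \in R))
  else if [pick i in S | v == s i] is Some i then Some (inr (g i)) else None.
have F_r i : F (r i) = Some (inl (C i, i \in R)) by rewrite /F br eqxx.
have F_inl z c : F z = Some (inl c) -> z = r (b z) /\ c = (C (b z), b z \in R).
  by rewrite /F; case: eqP => [? []|_]; last case: pickP.
have F_inr z n : F z = Some (inr n) -> exists i, [/\ i \in S, z = s i & g i = n].
  rewrite /F; case: eqP => // _; case: pickP => // i /andP[iS /eqP->] [<-].
  by exists i.
have F_s i : i \in S -> F (s i) = Some (inr (g i)).
  move=> iS; have [sV sr] := sS i iS; rewrite /F (bE _ _ sV) (negPf sr).
  case: pickP => [j /andP[jS /eqP sij]|/(_ i)]; last by rewrite iS eqxx.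
  congr (Some (inr (g _))); apply: N_inj; rewrite ?(subsetP SN) //.
  by rewrite -(bE _ _ sV) sij; apply/esym/bE; have [] := sS j jS.
(* The bit [true] is listed only for colors in [A], as [R] contains no others. The size is
   [1 + k + #|A| + uphalf #|N|]. *)
pose D : seq (option ('I_k * bool + nat)) :=
  None :: [seq Some (inl (c, false)) | c : 'I_k]
  ++ [seq Some (inl (c, true)) | c in A]
  ++ [seq Some (inr n) | n <- iota 0 (uphalf #|N|)].
have leD : (chi_ON e_noiso <= size D)%N; last first.
  have := cliques_of_color_count (Q := Q) (N := N) (C := C).
  rewrite -/A -/(cl e V) => count; have : (2 * #|A| + #|N| <= cl e V)%N.
    apply: count => [|i]; last by case/NP.
    by apply/subsetP => i /NP[].
  move: leD; rewrite /D -cat1s !size_cat !size_image card_ord size_map.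
  by rewrite size_iota /=; lia.
apply: (@chi_ON_le_size _ _ _ _ F) => v.
  rewrite inE !mem_cat; case Fv: (F v) => [[[c x]|n]|//]; apply/orP; right.
    have [_ [-> ->]] := F_inl _ _ Fv; case: (boolP (_ \in R)) => [|_].
      rewrite !inE => /and3P[_ CA _]; apply/orP; right; apply/orP; left.
      by apply: (image_f (fun c => Some (inl (c, true)))); rewrite inE.
    by apply/orP; left; apply: (image_f (fun c => Some (inl (c, false)))).
  have [i [iS _ <-]] := F_inr _ _ Fv; apply/orP; right; apply/orP; right.
  by apply: (map_f (fun n => Some (inr n))); rewrite mem_iota gS.
have vu : e v (r (u (b v))) by apply: type_graph_edge (bV v) (rV _) (Hu _).
case: (boolP (b v \in N)) => [vN|vN].
  have [i [iS vi iU]] := SP _ vN; have [sV _] := sS i iS.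
  exists (s i); first by apply: type_graph_edge (bV v) sV vi.
  rewrite F_s // => z vz /F_inr[j [jS zs gj]]; rewrite zs.
  have [sjV _] := sS j jS; congr s; apply: iU => //=.
  (* If [v] and [s j] shared a class, their edge would make [V (u j)] a clique, against [uN]. *)
  case: (edgeP _ _ vz); rewrite zs (bE _ _ sjV) // => -[bu bQ].
  by have := uN j (subsetP SN j jS); rewrite -bu bQ.
exists (r (u (b v))) => // z vz; rewrite F_r => /F_inl[zr [Cz Rz]].
(* A competitor [z] in the class of [v] makes [b v] bad; being outside [N], it has a color in [A],
   and the [R] bits of [b v] and [u (b v)] differ. *)
rewrite zr; congr r; case: (edgeP _ _ vz) => [vz'|[vz' bQ]]; first exact: uU.
have vB : b v \in B by rewrite inE bQ Cz vz' eqxx.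
case: (boolP (C (b v) \in A)) => CA; last by rewrite inE vB CA in vN.
by move: (RE _ vB CA); rewrite Rz -vz'; case: (_ \in R).
Qed.
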